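(* Let $\mathbb K$ be an algebraically closed field of characteristic $0$ and let $$\mathcal B=\mathrm{diag}(\underbrace{b_1,\ldots,b_1}_{\alpha_1},\ldots,\underbrace{b_m,\ldots,b_m}_{\alpha_m},a_1,\ldots,a_k)\in M_n(\mathbb K),$$ where $k,m\ge 0$ are integers, $a_1,\ldots,a_k,b_1,\ldots,b_m\in\mathbb K$ are pairwise distinct and $\alpha_1,\ldots,\alpha_m\ge 2$ are integers. Put $C_m=\alpha_1+\cdots+\alpha_m$ (with $C_0=0$) and $d_j=C_m+j$ for $j=1,\ldots,k$. Let $\mathcal A=\begin{pmatrix}\mathcal B & u^{\top}\\ v & \tau(\mathcal B)\end{pmatrix}\in M_{n+1}(\mathbb K)$, with $u=(u_1,\ldots,u_n)$, $v=(v_1,\ldots,v_n)\in\mathbb K^n$, be an integral of $\mathcal B$. Then $\mathcal A$ is diagonalizable if and only if the following two conditions hold simultaneously: 1. $u_1=v_1=\cdots=u_{C_m}=v_{C_m}=0$; 2. $v_{d_i}=u_{d_i}=0$ for every $i\in\{1,\ldots,k\}$ such that $p_{\mathcal A}(a_i)=0$.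
   Context: For a square matrix $M$, $p_M(x)=\det(xI-M)$. For $B\in M_n(\mathbb K)$ put $\tau(B)=\frac{1}{n}\mathrm{tr}(B)$. A matrix $A\in M_{n+1}(\mathbb K)$ is an integral of $B\in M_n(\mathbb K)$ if $A=\begin{pmatrix} B & u^{\top}\\ v & \tau(B)\end{pmatrix}$ for some row vectors $u,v\in\mathbb K^n$ and $p_B(x)=\frac{1}{n+1}p_A'(x)$. Diagonalizable means diagonalizable over $\mathbb K$. *)

(* Defs.v *)
From HB Require Import structures.
From mathcomp Require Import all_boot all_order all_algebra.

Set Implicit Arguments.
Unset Strict Implicit.
Unset Printing Implicit Defensive.

Import GRing.Theory.
Local Open Scope ring_scope.

(* For n = 0 the convention x / 0 = 0 gives tau B = 0. *)
Definition tau (K : fieldType) (n : nat) (B : 'M[K]_n) : K := n%:R^-1 * \tr B.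

Definition bordered (K : fieldType) (n : nat) (B : 'M[K]_n) (u v : 'rV[K]_n) :
    'M[K]_(n + 1) :=
  block_mx B u^T v (tau B)%:M.

Definition is_integral (K : fieldType) (n : nat)
    (A : 'M[K]_(n + 1)) (B : 'M[K]_n) : Prop :=
  (exists u v : 'rV[K]_n, A = bordered B u v)
  /\ char_poly B = (n + 1)%:R^-1 *: (char_poly A)^`().

Definition diagB (K : fieldType) (m k : nat) (alpha : 'I_m -> nat)
    (b : 'I_m -> K) (a : 'I_k -> K) : 'M[K]_(\sum_(i < m) alpha i + k) :=
  diag_mx (row_mx (\mxrow_(i < m) (const_mx (b i) : 'rV[K]_(alpha i)))
                  (\row_(j < k) a j)).

(* Main.v *)
(** Let A be an integral of D = diag(d).  As p_D is proportional to p_A', every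
    root x of p_A satisfies mult_x(p_A) = mult_x(p_D) + 1.  A matrix M is
    diagonalizable iff rank (M - x) + mult_x(p_M) equals its size for all roots
    x of p_M; as this holds for D, A is diagonalizable iff
    rank (A - x) = rank (D - x) for all roots x of p_A.  Since D - x is a block
    of A - x, this equality puts u^T and v into the column and row spaces of
    D - x, i.e. u_i = v_i = 0 whenever d_i = x.  Conversely, when these entries
    vanish, the identity p_A = p_D * (X - tau - sum_i u_i v_i / (X - d_i)) and the
    extra multiplicity at x kill the Schur complement of D - x in A - x, so the ranks
    agree.  A repeated d_i is always a root of p_A. *)
Require Import Defs.
From HB Require Import structures.
From mathcomp Require Import all_boot all_order all_algebra.

Set Implicit Arguments.
Unset Strict Implicit.
Unset Printing Implicit Defensive.

Import GRing.Theory.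
Local Open Scope ring_scope.

(** * Root multiplicities of polynomials and of their derivatives *)

Section Multiplicity.
Variable K : fieldType.
Implicit Types (p q : {poly K}) (x : K).

Lemma mup_factor x p : p != 0 ->
  exists2 q, ~~ root q x & p = q * ('X - x%:P) ^+ mup x p.
Proof.
move=> p0; have : ('X - x%:P) ^+ mup x p %| p by rewrite -mup_geq.
case/dvdpP=> q pE; exists q => //; apply/negP => /factor_theorem[r qE].
have : (mup x p < mup x p)%N; last by rewrite ltnn.
rewrite mup_geq //; apply/dvdpP; exists r.
by rewrite exprS mulrA -qE.
Qed.

(** If p = q (X - x)^(n+1) with q(x) != 0, then p' = (q' (X - x) + (n+1) q) (X - x)^n, and the first
    factor takes the value (n+1) q(x) at x, nonzero in characteristic 0. *)
Lemma mup_deriv x p : [pchar K] =i pred0 -> p != 0 -> root p x ->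
  mup x p = (mup x p^`()).+1.
Proof.
move=> /pcharf0P charK p0 px; have [q qx pE] := mup_factor x p0.
have mE : mup x p = (mup x p).-1.+1 by rewrite prednK // -XsubC_dvd // dvdp_XsubCl.
rewrite [LHS]mE; congr _.+1; move: (mup x p).-1 mE pE => n -> ->.
have -> : (q * ('X - x%:P) ^+ n.+1)^`()
    = (q^`() * ('X - x%:P) + q *+ n.+1) * ('X - x%:P) ^+ n.
  rewrite derivM deriv_exp derivXsubC mul1r exprS mulrA.
  by rewrite mulrnAr -mulrnAl -mulrDl.
rewrite mupMr ?mup_XsubCX ?eqxx // /root !hornerE subrr mulr0 add0r.
by rewrite hornerMn -mulr_natr mulf_neq0 ?charK.
Qed.

Lemma mup_prod_seq_XsubC (s : seq K) x :
  mup x (\prod_(z <- s) ('X - z%:P)) = count_mem x s.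
Proof.
elim: s => [|z s IHs]; first by rewrite big_nil mupNroot ?root1.
rewrite big_cons mupM ?polyXsubC_eq0 ?monic_neq0 ?monic_prod_XsubC // IHs.
by rewrite -['X - _]expr1 mup_XsubCX /=; case: eqP.
Qed.

Lemma mup_prod_XsubC (I : finType) (d : I -> K) x :
  mup x (\prod_i ('X - (d i)%:P)) = #|[pred i | d i == x]|.
Proof.
rewrite -(big_image _ _ _ _ (fun z => 'X - z%:P)) mup_prod_seq_XsubC.
by rewrite count_map cardE size_filter enumT.
Qed.
End Multiplicity.

(** * Ranks of diagonal and of bordered matrices *)

Section Rank.
Variable K : fieldType.

Lemma mxrank_diag_le n (d : 'rV[K]_n) :
  (\rank (diag_mx d) <= #|[pred i | (d 0 i != 0)%R]|)%N.
Proof.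
rewrite diag_mx_sum_delta -sum1_card [leqRHS]big_mkcond /=.
apply: (big_ind2 (fun (M : 'M_n) r => \rank M <= r)%N) => [|M1 r1 M2 r2 le1 le2|i _] /=.
- by rewrite mxrank0.
- exact: leq_trans (mxrank_add _ _) (leq_add le1 le2).
rewrite inE; case: (eqVneq (d 0 i) 0) => [->|_] /=; first by rewrite scale0r mxrank0.
by rewrite (leq_trans (mxrank_scale _ _)) // mxrank_delta.
Qed.

Lemma mxrank_diag n (d : 'rV[K]_n) :
  \rank (diag_mx d) = #|[pred i | d 0 i != 0]|.
Proof.
apply/eqP; rewrite eqn_leq mxrank_diag_le /=.
(* [e] marks the zeros of [d], so [d + e] has no zero entry; subadditivity of the rank turns the
   upper bound for [e] into a lower bound for [d]. *)
pose e := \row_i (d 0 i == 0)%:R : 'rV[K]_n.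
have rank_de : \rank (diag_mx d + diag_mx e)%R = n.
  apply: mxrank_unit; rewrite -raddfD unitmxE det_diag unitfE.
  apply/prodf_neq0 => i _; rewrite !mxE.
  by case: (eqVneq (d 0 i)) => [->|d0]; rewrite ?addr0 // add0r oner_neq0.
have := leq_trans (mxrank_add (diag_mx d) (diag_mx e))
                  (leq_add (leqnn _) (mxrank_diag_le e)).
rewrite rank_de -{1}[n]card_ord -(cardC [pred i | d 0 i != 0]).
suff -> : #|[pred i | e 0 i != 0]| = #|[predC [pred i | d 0 i != 0]]|.
  by rewrite leq_add2r.
by apply: eq_card => i; rewrite !inE mxE; case: (d 0 i == 0); rewrite ?oner_eq0 ?eqxx.
Qed.

Lemma mxrank_diag_subC n (d : 'rV[K]_n) x :
  (\rank (diag_mx d - x%:M)%R + mup x (\prod_i ('X - (d 0 i)%:P)))%N = n.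
Proof.
rewrite -diag_const_mx -raddfB /= mxrank_diag mup_prod_XsubC.
rewrite -[RHS]card_ord -(cardC [pred i | d 0 i != x]); congr (_ + _)%N.
  by apply: eq_card => i; rewrite !inE !mxE subr_eq0.
by apply: eq_card => i; rewrite !inE negbK.
Qed.

(** The top rows (D c) have rank at least that of D, so under the bound they span the row space of
    the whole matrix. Hence (r s) is a combination of them; dropping the last column gives the
    claim. *)
Lemma mxrank_block_sub n (D : 'M[K]_n) (c : 'cV_n) (r : 'rV_n) (s : 'M_1) :
  (\rank (block_mx D c r s) <= \rank D)%N -> (r <= D)%MS.
Proof.
move=> rankle; have subU : (row_mx D c <= block_mx D c r s)%MS.
  by rewrite /block_mx -addsmxE addsmxSl.
have rankDc : (\rank D <= \rank (row_mx D c))%N.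
  have {1}-> : D = row_mx D c *m col_mx 1%:M 0 by rewrite mul_row_col mulmx1 mulmx0 addr0.
  exact: mxrankM_maxl.
have subL : (row_mx r s <= row_mx D c)%MS.
  apply: submx_trans (_ : block_mx D c r s <= _)%MS.
    by rewrite /block_mx -addsmxE addsmxSr.
  by rewrite -(geq_leqif (mxrank_leqif_sup subU)) (leq_trans rankle).
have /(submxMr (col_mx 1%:M 0 : 'M_(n + 1, n))) := subL.
by rewrite !mul_row_col !mulmx1 !mulmx0 !addr0.
Qed.
End Rank.

(** * Diagonalizability in terms of ranks and multiplicities *)

Section Diagonalizable.
Variable K : fieldType.

Lemma char_poly_diag n (d : 'rV[K]_n) :
  char_poly (diag_mx d) = \prod_i ('X - (d 0 i)%:P).
Proof.
rewrite char_poly_trig ?diag_mx_is_trig //; apply: eq_bigr => i _.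
by rewrite mxE eqxx mulr1n.
Qed.

Lemma char_poly_similar n (P A B : 'M[K]_n) : P \in unitmx ->
  P *m A = B *m P -> char_poly A = char_poly B.
Proof.
move=> Pu PA; pose P' := map_mx polyC P.
have : P' *m char_poly_mx A = char_poly_mx B *m P'.
  by rewrite mulmxBr mulmxBl -!map_mxM PA scalar_mxC.
move/(congr1 determinant); rewrite !det_mulmx mulrC; apply: mulIf.
by rewrite det_map_mx polyC_eq0 -unitfE -unitmxE.
Qed.

Lemma diagonalizable_mxrank n (A : 'M[K]_n) x : diagonalizable A ->
  (\rank (A - x%:M)%R + mup x (char_poly A))%N = n.
Proof.
case=> P Pu /similar_diagPex[e /(similarP Pu) PA].
rewrite (char_poly_similar Pu PA) char_poly_diag -[RHS](mxrank_diag_subC e x).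
congr (_ + _)%N.
rewrite -(eqmxMfull (A - x%:M) (_ : row_full P)) ?row_full_unit //.
by rewrite mulmxBr PA scalar_mxC -mulmxBl mxrankMfree ?row_free_unit.
Qed.
End Diagonalizable.

(** Eigenspaces of distinct roots are in direct sum, and the hypothesis makes each at least as large
    as the multiplicity of its root. Over a closed field the multiplicities add up to n. *)
Lemma mxrank_diagonalizable (K : closedFieldType) n (A : 'M[K]_n) :
  (forall x, root (char_poly A) x ->
    (\rank (A - x%:M)%R + mup x (char_poly A) <= n)%N) ->
  diagonalizable A.
Proof.
move=> rankA; have [r] := closed_field_poly_normal (char_poly A).
rewrite (monicP (char_poly_monic A)) scale1r => rE.
have size_r : size r = n.
  by apply/succn_inj; rewrite -(size_char_poly A) rE size_prod_XsubC.
apply/diagonalizablePeigen; exists (undup r); rewrite ?undup_uniq //.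
apply/eqmxP; rewrite submx1 sub1mx /= /row_full eqn_leq rank_leq_col /=.
have uniq_rs := undup_uniq r; set rs := undup r in uniq_rs *.
have direct_rs : mxdirect (\sum_(i < size rs) eigenspace A rs`_i).
  apply: mxdirect_sum_eigenspace => i j _ _ eq_ij; apply/val_inj.
  by apply: uniqP eq_ij; rewrite ?inE.
have -> : \rank (\sum_(x <- rs) eigenspace A x)%MS
    = (\sum_(x <- rs) \rank (eigenspace A x))%N.
  rewrite (big_nth 0) [in RHS](big_nth 0) !big_mkord; exact: (mxdirectP direct_rs).
have sum_mup : (\sum_(x <- rs) mup x (char_poly A))%N = n.
  rewrite -[RHS]size_r -sum1_size -[RHS]big_undup_iterop_count; apply: eq_bigr => x _.
  rewrite rE mup_prod_seq_XsubC.
  by case: count => // m; rewrite iteropS iter_addn mul1n addn1.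
rewrite -[leqLHS]sum_mup big_seq [leqRHS]big_seq; apply: leq_sum => x.
rewrite mem_undup => rx; rewrite mxrank_ker leq_subRL ?rank_leq_row // rankA //.
by rewrite rE root_prod_XsubC.
Qed.

(** * Bordered diagonal matrices: determinant, characteristic polynomial, rank *)

Lemma det_bordered_diag (R : idomainType) n (d c r : 'rV[R]_n) (s : R) :
  (forall i, d 0 i != 0) ->
  \det (block_mx (diag_mx d) c^T r s%:M)
    = s * \prod_i d 0 i
      - \sum_i c 0 i * r 0 i * \prod_(j | j != i) d 0 j.
Proof.
move=> d0; set p := \prod_i d 0 i.
have p0 : p != 0 by apply/prodf_neq0.
(* [diag_mx e] is the adjugate of [diag_mx d]; avoiding inverses allows entries in K[X]. *)
pose e := \row_i \prod_(j | j != i) d 0 j.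
have de : diag_mx d *m diag_mx e = p%:M.
  rewrite mulmx_diag; apply/matrixP => i j; rewrite !mxE; congr (_ *+ _).
  by rewrite /p [RHS](bigD1 i).
pose M := block_mx 1%:M (- (diag_mx e *m c^T)) 0 p%:M : 'M_(n + 1).
have detM : \det M = p by rewrite det_ublock det1 mul1r det_scalar1.
(* Column elimination over R, the last column being scaled by p instead of
   dividing by the d_i. *)
apply: (mulIf p0).
have <- : \det (block_mx (diag_mx d) c^T r s%:M *m M)
    = \det (block_mx (diag_mx d) c^T r s%:M) * p by rewrite det_mulmx detM.
rewrite mulmx_block.
rewrite !mulmx1 !mulmx0 !addr0 !mulmxN mulmxA de -scalar_mxC addNr det_lblock.
rewrite det_diag -/p mulrC; congr (_ * p).
rewrite -scalar_mxM det_mx11 addrC !mxE eqxx mulr1n; congr (_ - _).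
apply: eq_bigr => i _; rewrite mul_diag_mx !mxE.
by rewrite mulrCA mulrC [r 0 i * _]mulrC.
Qed.

Section BorderedDiagonal.
Variable K : fieldType.

Lemma char_poly_bordered_diag n (d u v : 'rV[K]_n) :
  char_poly (bordered (diag_mx d) u v)
    = ('X - (tau (diag_mx d))%:P) * \prod_i ('X - (d 0 i)%:P)
      - \sum_i (u 0 i * v 0 i)%:P * \prod_(j | j != i) ('X - (d 0 j)%:P).
Proof.
pose X_d := \row_i ('X - (d 0 i)%:P).
have -> : char_poly (bordered (diag_mx d) u v)
    = \det (block_mx (diag_mx X_d) (map_mx (fun x => - x%:P) u)^T
                     (map_mx (fun x => - x%:P) v) ('X - (tau (diag_mx d))%:P)%:M).
  congr (\det _); rewrite /char_poly_mx /bordered map_block_mx scalar_mx_block.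
  rewrite opp_block_mx add_block_mx !add0r map_scalar_mx -raddfB /=.
  congr block_mx; apply/matrixP => i j; rewrite !mxE //.
  by rewrite raddfMn -mulrnBl.
rewrite det_bordered_diag => [|i]; last by rewrite mxE polyXsubC_eq0.
under eq_bigr do rewrite mxE; congr (_ - _); apply: eq_bigr => i _.
rewrite !mxE mulrNN polyCM; congr (_ * _).
by apply: eq_bigr => j _; rewrite mxE.
Qed.

(** In the expanded characteristic polynomial, each product omitting one index still contains the
    factor of i or that of j, and both vanish at [d 0 i]. *)
Lemma root_char_poly_bordered_diag n (d u v : 'rV[K]_n) i j :
  i != j -> d 0 i = d 0 j ->
  (char_poly (bordered (diag_mx d) u v)).[d 0 i] = 0.
Proof.
move=> ij dij; rewrite char_poly_bordered_diag hornerD hornerM hornerN horner_sum.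
rewrite horner_prod (bigD1 i) //= !hornerXsubC subrr mul0r mulr0 sub0r.
rewrite big1 ?oppr0 // => l _; rewrite hornerM horner_prod.
have [li|li] := eqVneq l i.
  by rewrite (bigD1 j) /= ?li 1?eq_sym // hornerXsubC dij subrr mul0r mulr0.
by rewrite (bigD1 i) /= 1?eq_sym // hornerXsubC subrr mul0r mulr0.
Qed.

Lemma bordered_sub n (B : 'M[K]_n) (u v : 'rV[K]_n) x :
  bordered B u v - x%:M = block_mx (B - x%:M) u^T v (tau B - x)%:M.
Proof.
by rewrite /bordered [x%:M]scalar_mx_block opp_block_mx add_block_mx !subr0 -raddfB.
Qed.

Lemma mup_integral n (A : 'M[K]_(n + 1)) (B : 'M[K]_n) x :
  [pchar K] =i pred0 -> is_integral A B -> root (char_poly A) x ->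
  mup x (char_poly A) = (mup x (char_poly B)).+1.
Proof.
move=> charK [_ pB] rootA.
rewrite (mup_deriv charK) ?monic_neq0 ?char_poly_monic //; congr _.+1.
(* The scalar 1/(n+1) is nonzero because the monic [char_poly B] is a multiple of it. *)
have := monic_neq0 (char_poly_monic B); rewrite pB -mul_polyC mulf_eq0 negb_or.
by case/andP=> c0 _; rewrite mupMr // rootC -polyC_eq0.
Qed.

Lemma diagonalizable_bordered_diag0 n (d u v : 'rV[K]_n) i :
  [pchar K] =i pred0 ->
  is_integral (bordered (diag_mx d) u v) (diag_mx d) ->
  diagonalizable (bordered (diag_mx d) u v) ->
  root (char_poly (bordered (diag_mx d) u v)) (d 0 i) ->
  u 0 i = 0 /\ v 0 i = 0.
Proof.
set A := bordered _ _ _; set x := d 0 i => charK intA diagA rootA.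
(* Passing from D to A raises both the size and the multiplicity of x by one, so the ranks agree. *)
have rankA : \rank (A - x%:M)%R = \rank (diag_mx d - x%:M)%R.
  have := diagonalizable_mxrank x diagA.
  have := mxrank_diag_subC d x; rewrite -char_poly_diag => rankD.
  rewrite (mup_integral charK intA rootA) => rankA.
  apply: (@addIn (mup x (char_poly (diag_mx d))).+1).
  by rewrite [LHS]rankA [RHS]addnS rankD addn1.
(* Column i of D - x is zero. *)
have mulD0 (w : 'rV_n) : (w *m (diag_mx d - x%:M)) 0 i = 0.
  by rewrite mulmxBr mul_mx_diag mul_mx_scalar !mxE mulrC subrr.
have blockA := bordered_sub (diag_mx d) u v x; rewrite -/A in blockA.
split; last first.
  have /submxP[w ->] : (v <= diag_mx d - x%:M)%MS; last exact: mulD0.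
  by apply: (@mxrank_block_sub _ _ _ u^T _ (tau (diag_mx d) - x)%:M);
    rewrite -blockA rankA.
(* Transposition exchanges u and v and preserves the rank. *)
have /submxP[w ->] : (u <= diag_mx d - x%:M)%MS; last exact: mulD0.
apply: (@mxrank_block_sub _ _ _ v^T _ (tau (diag_mx d) - x)%:M).
rewrite -rankA -[leqRHS]mxrank_tr blockA tr_block_mx trmxK tr_scalar_mx.
by rewrite linearB /= tr_diag_mx tr_scalar_mx.
Qed.

(* The terms with d_i = x on the right-hand side are 0 / 0 = 0. *)
Lemma root_schur_complement n (d u v : 'rV[K]_n) x :
  (forall i, d 0 i = x -> u 0 i = 0 /\ v 0 i = 0) ->
  (mup x (char_poly (diag_mx d))
     < mup x (char_poly (bordered (diag_mx d) u v)))%N ->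
  x - tau (diag_mx d) = \sum_i u 0 i * v 0 i / (x - d 0 i).
Proof.
move=> uv0; rewrite char_poly_diag char_poly_bordered_diag.
(* [Q] collects the factors vanishing at x: p_D = h Q and p_A = g Q with h(x) != 0. The larger
   multiplicity in p_A forces g(x) = 0, and dividing by h(x) gives the formula. *)
set t := tau _; pose h := \prod_(j | d 0 j != x) ('X - (d 0 j)%:P).
pose Q := \prod_(j | ~~ (d 0 j != x)) ('X - (d 0 j)%:P).
pose h' i := \prod_(j | (j != i) && (d 0 j != x)) ('X - (d 0 j)%:P).
pose g := ('X - t%:P) * h - \sum_i (u 0 i * v 0 i)%:P * h' i.
have hQ : \prod_i ('X - (d 0 i)%:P) = h * Q by rewrite (bigID (fun j => d 0 j != x)).
have gQ : ('X - t%:P) * (h * Q)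
    - \sum_i (u 0 i * v 0 i)%:P * \prod_(j | j != i) ('X - (d 0 j)%:P) = g * Q.
  rewrite [RHS]mulrBl mulrA mulr_suml; congr (_ - _); apply: eq_bigr => i _.
  have [/uv0[-> _]|dix] := eqVneq (d 0 i) x; first by rewrite mul0r !mul0r.
  rewrite -mulrA (bigID (fun j => d 0 j != x)) /=; congr (_ * (_ * _)).
  apply: eq_bigl => j; rewrite negbK andbC.
  by case: (eqVneq (d 0 j) x) => // djx; case: eqP => // ji; rewrite -djx ji eqxx in dix.
have hx0 : ~~ root h x.
  rewrite /root horner_prod; apply/prodf_neq0 => j djx.
  by rewrite hornerXsubC subr_eq0 eq_sym.
have [gx0|gx0] := boolP (root g x); last by rewrite hQ gQ !mupMr // ltnn.
move=> _; apply: (mulIf hx0); apply/eqP; rewrite -subr_eq0.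
move: gx0; rewrite /root /g hornerD hornerN hornerM hornerXsubC horner_sum.
rewrite mulr_suml; congr (_ - _ == 0); apply: eq_bigr => i _.
rewrite hornerM hornerC.
have [/uv0[-> _]|dix] := eqVneq (d 0 i) x; first by rewrite !mul0r.
have -> : h = ('X - (d 0 i)%:P) * h' i.
  by rewrite /h (bigD1 i) //=; congr (_ * _); apply: eq_bigl => j; rewrite andbC.
rewrite hornerM hornerXsubC mulrA divfK //.
by rewrite subr_eq0 eq_sym.
Qed.

Lemma mxrank_bordered_diag n (d u v : 'rV[K]_n) x :
  (forall i, d 0 i = x -> u 0 i = 0 /\ v 0 i = 0) ->
  (mup x (char_poly (diag_mx d))
     < mup x (char_poly (bordered (diag_mx d) u v)))%N ->
  (\rank (bordered (diag_mx d) u v - x%:M)%R <= \rank (diag_mx d - x%:M)%R)%N.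
Proof.
move=> uv0 ltmup; have tE := root_schur_complement uv0 ltmup.
(* [q w] solves y (D - x) = w when w vanishes wherever d_i = x; there the quotient is 0 / 0 = 0. *)
pose q (w : 'rV[K]_n) := \row_i (w 0 i / (d 0 i - x)).
have qD (w : 'rV_n) : (forall i, d 0 i = x -> w 0 i = 0) ->
    q w *m (diag_mx d - x%:M) = w.
  move=> w0; rewrite mulmxBr mul_mx_diag mul_mx_scalar; apply/rowP => i.
  rewrite !mxE [x * _]mulrC -mulrBr.
  have [dix|dix] := eqVneq (d 0 i) x; first by rewrite w0 // !mul0r.
  by rewrite mulfVK // subr_eq0.
have qDu : (diag_mx d - x%:M) *m (q u)^T = u^T.
  rewrite -[X in X *m _]trmxK -trmx_mul linearB /= tr_diag_mx tr_scalar_mx qD //.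
  by move=> i /uv0[].
have qDv : q v *m (diag_mx d - x%:M) = v by apply: qD => i /uv0[].
(* The corner of this product is the sum of u_i v_i / (d_i - x), which [tE] identifies with tau -
   x. *)
have -> : bordered (diag_mx d) u v - x%:M =
    col_mx 1%:M (q v) *m (diag_mx d - x%:M) *m row_mx 1%:M (q u)^T.
  rewrite bordered_sub mul_col_mx mul_col_row mul1mx !mulmx1 qDu qDv.
  congr block_mx; apply/rowP => i; rewrite ord1 !mxE eqxx mulr1n -[LHS]opprB tE.
  rewrite -sumrN; apply: eq_bigr => j _.
  by rewrite !mxE -mulrN -invrN opprB mulrCA mulrA.
exact: leq_trans (mxrankM_maxl _ _) (mxrankM_maxr _ _).
Qed.

End BorderedDiagonal.

(** * The criterion for a diagonal matrix and its form for grouped entries *)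

Lemma diagonalizable_bordered_diag (K : closedFieldType) n (d u v : 'rV[K]_n) :
  [pchar K] =i pred0 ->
  is_integral (bordered (diag_mx d) u v) (diag_mx d) ->
  diagonalizable (bordered (diag_mx d) u v) <->
  (forall i, (char_poly (bordered (diag_mx d) u v)).[d 0 i] = 0 ->
     u 0 i = 0 /\ v 0 i = 0).
Proof.
move=> charK intA; split=> [diagA i /rootP|uv0].
  exact: diagonalizable_bordered_diag0.
apply: mxrank_diagonalizable => x rootA.
rewrite (mup_integral charK intA rootA) [leqRHS]addn1 addnS ltnS.
rewrite -[leqRHS](mxrank_diag_subC d x) -char_poly_diag leq_add2r.
apply: mxrank_bordered_diag; last by rewrite (mup_integral charK intA rootA).
by move=> i dix; apply: uv0; rewrite dix; apply/rootP.
Qed.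

(** The block containing i has at least two positions, and j is another position in it. *)
Lemma mxrow_const_repeated (K : fieldType) m (alpha : 'I_m -> nat) (b : 'I_m -> K)
    (i : 'I_(\sum_(j < m) alpha j)) :
  (forall j, (2 <= alpha j)%N) ->
  exists2 j, i != j &
    (\mxrow_(l < m) (const_mx (b l) : 'rV[K]_(alpha l))) 0 i
      = (\mxrow_(l < m) (const_mx (b l) : 'rV[K]_(alpha l))) 0 j.
Proof.
move=> alpha_ge2; pose l := tagnat.sig1 i.
have : (0 < #|predC1 (tagnat.sig2 i)|)%N.
  by rewrite cardC1 card_ord -subn1 subn_gt0 alpha_ge2.
case/card_gt0P => r; rewrite inE => ri; exists (tagnat.Rank l r).
  apply: contraNneq ri => iE; apply/eqP/val_inj.
  have /(congr1 (@nat_of_ord _)) : tagnat.Rank _ (tagnat.sig2 i) = tagnat.Rank _ r.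
    by rewrite tagnat.sig2K.
  by rewrite !tagnat.RankEsum => /addnI.
by rewrite !mxE tagnat.Rank1K.
Qed.

Theorem theorem4p1 (K : closedFieldType) (charK : [pchar K] =i pred0)
    (m k : nat) (alpha : 'I_m -> nat) (b : 'I_m -> K) (a : 'I_k -> K)
    (alpha_ge2 : forall i : 'I_m, (2 <= alpha i)%N)
    (b_inj : injective b) (a_inj : injective a)
    (ab_neq : forall (i : 'I_k) (j : 'I_m), a i != b j)
    (u v : 'rV[K]_(\sum_(i < m) alpha i + k))
    (A_integral : is_integral (bordered (diagB alpha b a) u v)
                              (diagB alpha b a)) :
  diagonalizable (bordered (diagB alpha b a) u v) <->
  ((forall i : 'I_(\sum_(j < m) alpha j),
      u 0 (lshift k i) = 0 /\ v 0 (lshift k i) = 0)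
   /\ (forall i : 'I_k,
      (char_poly (bordered (diagB alpha b a) u v)).[a i] = 0 ->
      v 0 (rshift (\sum_(j < m) alpha j) i) = 0
      /\ u 0 (rshift (\sum_(j < m) alpha j) i) = 0)).
Proof.
rewrite /diagB in A_integral *; set d := row_mx _ _ in A_integral *.
apply: iff_trans (diagonalizable_bordered_diag charK A_integral) _.
have dL i : d 0 (lshift k i)
    = (\mxrow_(l < m) (const_mx (b l) : 'rV[K]_(alpha l))) 0 i by rewrite row_mxEl.
have dR i : d 0 (rshift _ i) = a i by rewrite row_mxEr mxE.
split=> [uv0|[uvL uvR] i].
  split=> i; last by rewrite -dR => /uv0[].
  (* A repeated diagonal entry is always a root of p_A, so the criterion applies to the whole left
     block. *)
  have [j ij dij] := mxrow_const_repeated b i alpha_ge2.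
  apply/uv0/(@root_char_poly_bordered_diag _ _ _ _ _ _ (lshift k j)).
    by rewrite (inj_eq (@lshift_inj _ _)).
  by rewrite !dL.
by case: (split_ordP i) => j ->; [move=> _; apply: uvL | rewrite dR => /uvR[]].
Qed.
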